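(* Let $k$ be a perfect field which is not of type $(F)$. Then there exists $n$ such that the group $GL_n(k)$ has infinitely many $z$-classes of semisimple elements.
   Context: Two elements $x,y$ of a group $\Gamma$ are called $z$-equivalent if their centralisers in $\Gamma$ are conjugate as subgroups of $\Gamma$. The equivalence classes of this relation are the $z$-classes of $\Gamma$; a $z$-class of semisimple elements means the $z$-class of a semisimple element of $\Gamma$. A field $k$ is of type $(F)$ if it is perfect and, for every integer $n$, there exist only finitely many extensions of $k$ of degree $n$ inside a fixed algebraic closure $\overline{k}$ of $k$. *)

(* Defs.v *)
From HB Require Import structures.
From mathcomp Require Import all_boot all_order all_algebra all_field.
From mathcomp Require Import all_classical.

Set Implicit Arguments.
Unset Strict Implicit.
Unset Printing Implicit Defensive.

Import GRing.Theory.
Local Open Scope ring_scope.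
Local Open Scope classical_set_scope.

Section ZClasses.
Variable G : groupType.
Implicit Types x y g : G.

Definition elt_centraliser x : set G := [set h | commute x h].

Definition zequiv x y : Prop :=
  exists g, [set conjg h g | h in elt_centraliser x] = elt_centraliser y.

Definition zclass x : set G := [set y | zequiv x y].

End ZClasses.

(* The library's {'GL_n[R]} requires R to be finite. *)
Section GeneralLinear.
Variables (k : fieldType) (n : nat).

Record GL := MkGL { GL_val :> 'M[k]_n; GL_unit : GL_val \in unitmx }.

HB.instance Definition _ := [isSub for GL_val].
HB.instance Definition _ := [Choice of GL by <:].

Implicit Types A B C : GL.

Fact GL_one_subproof : (1%:M : 'M[k]_n) \in unitmx.
Proof. exact: unitmx1. Qed.
Fact GL_mul_subproof A B : (A : 'M_n) *m (B : 'M_n) \in unitmx.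
Proof. by rewrite unitmx_mul !GL_unit. Qed.
Fact GL_inv_subproof A : invmx (A : 'M_n) \in unitmx.
Proof. by rewrite unitmx_inv GL_unit. Qed.

Definition GL_one := MkGL GL_one_subproof.
Definition GL_mul A B := MkGL (GL_mul_subproof A B).
Definition GL_inv A := MkGL (GL_inv_subproof A).

Fact GL_mulA : associative GL_mul.
Proof. by move=> A B C; apply/val_inj; rewrite /= mulmxA. Qed.
Fact GL_mul1 : left_id GL_one GL_mul.
Proof. by move=> A; apply/val_inj; rewrite /= mul1mx. Qed.
Fact GL_mulr1 : right_id GL_one GL_mul.
Proof. by move=> A; apply/val_inj; rewrite /= mulmx1. Qed.
Fact GL_mulV : left_inverse GL_one GL_inv GL_mul.
Proof. by move=> A; apply/val_inj; rewrite /= mulVmx ?GL_unit. Qed.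
Fact GL_mulrV : right_inverse GL_one GL_inv GL_mul.
Proof. by move=> A; apply/val_inj; rewrite /= mulmxV ?GL_unit. Qed.

HB.instance Definition _ :=
  isGroup.Build GL GL_mulA GL_mul1 GL_mulr1 GL_mulV GL_mulrV.

End GeneralLinear.

Definition perfect_field (k : fieldType) : Prop :=
  forall p : {poly k}, irreducible_poly p -> separable_poly p.

(* iota presents kbar as an algebraic closure of k: kbar is algebraically
   closed by its type, and algebraic over k by this predicate. *)
Definition algebraic_closure (k : fieldType) (kbar : closedFieldType)
    (iota : {rmorphism k -> kbar}) : Prop :=
  forall x : kbar, algebraicOver iota x.

Section OverClosure.
Variables (k : fieldType) (kbar : closedFieldType).
Variable iota : {rmorphism k -> kbar}.

(* The subfields K of kbar that contain k and have degree n over k, given as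
   the images of the k-embeddings into kbar of field extensions of degree n;
   they are compared as subsets of kbar, not up to isomorphism. *)
Definition subextension (n : nat) (K : set kbar) : Prop :=
  exists (L : fieldExtType k) (f : {rmorphism L -> kbar}),
    [/\ forall a : k, f a%:A = iota a, \dim {:L} = n & K = range f].

Definition type_F : Prop :=
  perfect_field k /\ forall n : nat, finite_set [set K | subextension n K].

Definition semisimple (n : nat) (A : GL k n) : Prop :=
  diagonalizable (map_mx iota A).

Definition semisimple_zclasses (n : nat) : set (set (GL k n)) :=
  [set zclass A | A in [set A | semisimple A]].

End OverClosure.

Arguments semisimple_zclasses {k kbar} iota n _.

(* Main.v *)
(* If k is perfect and not of type (F), some degree n has infinitely many
   subextensions K = k(a) of kbar.  Let A be the companion matrix of the minimal
   polynomial of a: it is semisimple, has a as an eigenvalue, and every matrix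
   commuting with it is a polynomial in A.  If A and B are two such matrices
   with conjugate centralisers, then, up to conjugation, B = q(A) and A = p(B),
   so b = q(a) is an eigenvalue of B and a = p(b), that is k(a) = k(b).  As B has
   finitely many eigenvalues, each z-class accounts for finitely many K. *)
Require Import Defs.
From HB Require Import structures.
From mathcomp Require Import all_boot all_order all_algebra all_field.
From mathcomp Require Import all_classical.

Set Implicit Arguments.
Unset Strict Implicit.
Unset Printing Implicit Defensive.

Import GRing.Theory.
Local Open Scope ring_scope.
Local Open Scope classical_set_scope.

Lemma mulmx_horner_eigen (F : fieldType) (n : nat) (A : 'M[F]_n.+1)
    (v : 'rV[F]_n.+1) (a : F) (q : {poly F}) :
  v *m A = a *: v -> v *m horner_mx A q = q.[a] *: v.
Proof.
move=> vA; elim/poly_ind: q => [|q c IHq].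
  by rewrite rmorph0 mulmx0 horner0 scale0r.
rewrite rmorphD rmorphM /= horner_mx_X horner_mx_C hornerMXaddC mulmxDr.
by rewrite mulmxA IHq -scalemxAl vA scalerA mul_mx_scalar scalerDl.
Qed.

(** Only invertible [M] are tested, because the centralisers to be compared are taken inside the
    general linear group. *)
Definition poly_centraliser (F : fieldType) (n : nat) (A : 'M[F]_n.+1) : Prop :=
  forall M, M \in unitmx -> A *m M = M *m A -> exists q, M = horner_mx A q.

(* The first basis vector is cyclic for a shift, so a matrix commuting with the
   shift is determined by its first row. *)
Lemma shift_poly_centraliser (F : fieldType) (n : nat) (A : 'M[F]_n.+1) :
  (forall i j : 'I_n.+1, i.+1 = j ->
     delta_mx 0 i *m A = delta_mx 0 j :> 'rV_n.+1) ->
  poly_centraliser A.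
Proof.
move=> shiftA M _ AM.
have e0X (i : 'I_n.+1) : delta_mx 0 0 *m A ^+ i = delta_mx 0 i :> 'rV_n.+1.
  case: i => i; elim: i => [|i IHi] lti.
    by rewrite expr0 mulmx1; congr (delta_mx _ _); apply/val_inj.
  by rewrite exprSr mulmxA (IHi (ltnW lti)) (shiftA _ (Ordinal lti)).
pose q := \poly_(i < n.+1) M 0 (inord i); exists q.
have e0q : delta_mx 0 0 *m horner_mx A q = delta_mx 0 0 *m M :> 'rV_n.+1.
  rewrite /q poly_def linear_sum mulmx_sumr -rowE [row 0 M]row_sum_delta.
  apply: eq_bigr => i _.
  by rewrite linearZ rmorphXn /= horner_mx_X -scalemxAr e0X mxE inord_val.
have powC X (i : nat) : A *m X = X *m A -> A ^+ i *m X = X *m A ^+ i.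
  by move=> AX; apply/esym/(@commrX _ X A i)/esym.
have Aq : A *m horner_mx A q = horner_mx A q *m A.
  exact: comm_mx_horner.
(* Row [i] of [M] is [e0 A^i M = e0 M A^i], and likewise for [q(A)]; so agreement on [e0]
   suffices. *)
apply/row_matrixP => i; rewrite !rowE -e0X -!mulmxA.
by rewrite (powC _ _ Aq) (powC _ _ AM) !mulmxA e0q.
Qed.

Lemma companion_poly_centraliser (F : fieldType) (n : nat) (p : {poly F}) :
  p \is monic -> size p = n.+2 ->
  exists2 A : 'M[F]_n.+1, char_poly A = p & poly_centraliser A.
Proof.
move=> p_monic szp; have szp' : (size p).-1 = n.+1 by rewrite szp.
suff [A chA shiftA] : exists2 A : 'M[F]_n.+1, char_poly A = p &
    forall i j : 'I_n.+1, i.+1 = j ->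
      delta_mx 0 i *m A = delta_mx 0 j :> 'rV_n.+1.
  by exists A => //; apply: shift_poly_centraliser.
rewrite -szp'; exists (companionmx p); first exact: companionmxK.
move=> i j ij; have lti : (i.+1 < (size p).-1)%N by rewrite ij.
by rewrite (mulmx_delta_companion lti); congr (delta_mx _ _); apply/val_inj.
Qed.

(** The characteristic polynomial splits into distinct linear factors, and the minimal polynomial
    divides it. *)
Lemma separable_char_diagonalizable (F : closedFieldType) (n : nat)
    (A : 'M[F]_n.+1) :
  separable_poly (char_poly A) -> diagonalizable A.
Proof.
have [rs chA] := closed_field_poly_normal (char_poly A).
rewrite (monicP (char_poly_monic A)) scale1r in chA.
rewrite chA separable_prod_XsubC => uniq_rs.
by apply/diagonalizableP; exists rs; rewrite -?chA ?mxminpoly_dvd_char.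
Qed.

(** [minPoly 1 x] is a polynomial over [L]; it is descended to [k], where irreducibility yields
    separability by perfectness. *)
Lemma perfect_minPoly (k : fieldType) (L : fieldExtType k) (x : L) :
  perfect_field k ->
  exists2 p : {poly k}, map_poly (in_alg L) p = minPoly 1 x & separable_poly p.
Proof.
move=> perf_k; have /polyOver1P[p Dp] := minPolyOver 1 x.
exists p => //; apply: perf_k; split.
  by rewrite -(size_map_poly (in_alg L)) -Dp size_minPoly.
move=> q szq q_dvd_p.
have := @minPoly_irr _ _ 1%AS x (map_poly (in_alg L) q).
rewrite Dp dvdp_map q_dvd_p eqp_map => /(_ (alg_polyOver _ _) isT) /orP[] //.
by rewrite -size_poly_eq1 size_map_poly (negPf szq).
Qed.

(** The generator is required to be nonzero so that the companion matrix of its minimal polynomial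
    is invertible. *)
Lemma perfect_primitive_element (k : fieldType) (L : fieldExtType k) :
  perfect_field k -> exists2 x : L, x != 0 & <<1; x>>%VS = fullv.
Proof.
move=> perf_k; have sep : separable 1 {:L}.
  apply/separableP => x _; have [p Dp sep_p] := perfect_minPoly x perf_k.
  by rewrite /separable_element -Dp separable_map.
have Lx := eq_adjoin_separable_generator sep (sub1v _).
set x := separable_generator _ _ in Lx.
have [x0|x_neq0] := eqVneq x 0; last by exists x.
(* If 0 generates, then [L] is [k] itself, which 1 generates as well. *)
exists 1; first exact: oner_neq0.
rewrite Lx x0.
by rewrite (Fadjoin_idP (mem0v _)) (Fadjoin_idP (mem1v _)).
Qed.

(** This is the ring k[a], which equals the field k(a) when [a] is algebraic over [k]. *)
Definition field_adjoin (k K : fieldType) (iota : {rmorphism k -> K}) (a : K) :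
    set K :=
  range (fun q : {poly k} => (map_poly iota q).[a]).

Lemma field_adjoin_poly (k K : fieldType) (iota : {rmorphism k -> K}) (a : K)
    (q : {poly k}) :
  field_adjoin iota (map_poly iota q).[a] `<=` field_adjoin iota a.
Proof.
move=> _ [r _ <-]; exists (r \Po q) => //.
by rewrite map_comp_poly horner_comp.
Qed.

Section SimpleSubextensions.
Variables (k : fieldType) (kbar : closedFieldType).
Variable iota : {rmorphism k -> kbar}.

Lemma subextension_matrix (n : nat) (K : set kbar) :
  perfect_field k -> subextension iota n.+1 K ->
  exists A : GL k n.+1,
    [/\ semisimple iota A, poly_centraliser A &
        exists2 a, eigenvalue (map_mx iota A) a & K = field_adjoin iota a].
Proof.
move=> perf_k [L [f [f_iota dimL ->]]].
have [x x_neq0 Lx] := perfect_primitive_element L perf_k.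
have [p Dp sep_p] := perfect_minPoly x perf_k.
have f_map q : map_poly f (map_poly (in_alg L) q) = map_poly iota q.
  by rewrite -map_poly_comp; apply: eq_map_poly => c /=; rewrite f_iota.
have p_monic : p \is monic by rewrite -(map_monic (in_alg L)) Dp monic_minPoly.
have szp : size p = n.+2.
  rewrite -(size_map_poly (in_alg L)) Dp size_minPoly.
  by have := dim_Fadjoin 1%AS x; rewrite Lx dimL dimv1 muln1 => <-.
have [A chA cenA] := companion_poly_centraliser p_monic szp.
have A_unit : A \in unitmx.
  rewrite unitmxE unitfE; apply: contra x_neq0 => /eqP detA.
  (* The constant term of [p] is the determinant of [A] up to sign. If it vanished, the irreducible
     minimal polynomial would be associate to ['X], forcing [x = 0]. *)
  have : 'X %| minPoly 1 x.
    rewrite -['X]subr0 -polyC0 dvdp_XsubCl -Dp rootE horner_coef0 coef_map.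
    by rewrite -chA char_poly_det detA mulr0 raddf0.
  move=> /(minPoly_irr (polyOverX _)) /orP[eqX|]; last first.
    by rewrite -size_poly_eq1 size_polyX.
  by have := root_minPoly 1 x; rewrite -(eqp_root eqX) rootE hornerX.
exists (MkGL A_unit); split => //=.
  apply: separable_char_diagonalizable.
  by rewrite -map_char_poly chA separable_map.
exists (f x).
  rewrite eigenvalue_root_char -map_char_poly chA -f_map fmorph_root Dp.
  exact: root_minPoly.
apply/seteqP; split=> [_ [y _ <-]|_ [q _ <-]].
  have /Fadjoin1_polyP[q ->] : y \in <<1; x>>%VS by rewrite Lx memvf.
  by exists q => //; rewrite -f_map horner_map.
by exists (map_poly (in_alg L) q).[x]; rewrite // -f_map horner_map.
Qed.

Lemma zequiv_field_adjoin (n : nat) (A B : GL k n.+1) (a : kbar) :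
  poly_centraliser A -> poly_centraliser B -> zequiv B A ->
  eigenvalue (map_mx iota A) a ->
  exists2 b, eigenvalue (map_mx iota B) b &
             field_adjoin iota a = field_adjoin iota b.
Proof.
move=> cenA cenB [g ZBA] /eigenvalueP[v vA v_neq0].
pose g' : GL k n.+1 := g; pose G := map_mx iota g'.
have GU : G \in unitmx by rewrite map_unitmx (Defs.GL_unit g').
(* [B] lies in its own centraliser, so its conjugate by [g] commutes with [A]. *)
have [q Bq] : exists q, invmx g' *m B *m g' = horner_mx A q.
  have : elt_centraliser A (conjg B g) by rewrite -ZBA; exists B.
  move=> /(congr1 val) AB; have -> : invmx g' *m B *m g' = val (conjg B g).
    by rewrite /= mulmxA.
  exact: cenA (Defs.GL_unit (conjg B g')) AB.
(* Conversely, [A] is the conjugate of some [h] commuting with [B]. *)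
have [p Ap] : exists p, A = invmx g' *m horner_mx B p *m g' :> 'M_n.+1.
  have : elt_centraliser A A by [].
  rewrite -ZBA => -[h /(congr1 val) Bh <-].
  have [p hp] := cenB h (Defs.GL_unit h) Bh.
  by exists p; rewrite -hp /= mulmxA.
pose w := v *m invmx G; have wG : w *m G = v by rewrite mulmxKV.
have wB : w *m map_mx iota B = (map_poly iota q).[a] *: w.
  have := congr1 (map_mx iota) Bq; rewrite map_horner_mx !map_mxM map_invmx.
  move/(congr1 (mulmx v)); rewrite (mulmx_horner_eigen _ vA) !mulmxA -/w.
  by move/(congr1 (mulmx^~ (invmx G))); rewrite mulmxK // -scalemxAl.
(* Both sides are the eigenvalue of [A] on [v], the right one computed through [w]. *)
have Da : a = (map_poly iota p).[(map_poly iota q).[a]].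
  apply/eqP; rewrite -subr_eq0; have /eqP := vA.
  rewrite {1}Ap !map_mxM map_invmx map_horner_mx !mulmxA -/w.
  rewrite (mulmx_horner_eigen _ wB) -scalemxAl wG eq_sym -subr_eq0 -scalerBl.
  by rewrite scaler_eq0 (negPf v_neq0) orbF.
exists (map_poly iota q).[a].
  apply/eigenvalueP; exists w => //; apply: contra v_neq0 => /eqP w0.
  by rewrite -wG w0 mul0mx.
apply/seteqP; split; last exact: field_adjoin_poly.
by rewrite [X in field_adjoin _ X `<=` _]Da; apply: field_adjoin_poly.
Qed.

End SimpleSubextensions.

Lemma finite_eigenvalues (F : closedFieldType) (n : nat) (A : 'M[F]_n) :
  finite_set [set a | eigenvalue A a].
Proof.
have [rs chA] := closed_field_poly_normal (char_poly A).
rewrite (monicP (char_poly_monic A)) scale1r in chA.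
apply: sub_finite_set (finite_seq rs) => a /=.
by rewrite eigenvalue_root_char chA root_prod_XsubC.
Qed.

Theorem proposition5p2 (k : fieldType) (kbar : closedFieldType)
    (iota : {rmorphism k -> kbar}) (hkbar : algebraic_closure iota)
    (hperfect : perfect_field k) (hnotF : ~ type_F iota) :
  exists n : nat, infinite_set (semisimple_zclasses iota n).
Proof.
have [n infK] : exists n, infinite_set [set K | subextension iota n K].
  apply: contrapT => /forallNP fin; apply: hnotF; split=> // n.
  exact: contrapT (fin n).
exists n => finZ; apply: infK; case: n finZ => [|n] finZ.
  (* No extension has degree 0. *)
  apply: (sub_finite_set _ (finite_set0 _)) => K [L [f [_ dimL _]]].
  by have := adim_gt0 {:L}%AS; rewrite dimL.
(* One matrix with polynomial centraliser is chosen in each class. Classes without any get the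
   identity, which is harmless: [fields C] is finite in every case. *)
pose rep C := xget (GL_one k n.+1)
  [set A : GL k n.+1 | poly_centraliser A /\ zclass A = C].
pose fields C := [set field_adjoin iota a | a in
  [set a | eigenvalue (map_mx iota (rep C)) a]].
apply: sub_finite_set (bigcup_finite finZ (F := fields) _) => [K subK|C _];
  last exact/finite_image/finite_eigenvalues.
have [A [ssA cenA [a Aa ->]]] := subextension_matrix hperfect subK.
exists (zclass A); first by exists A.
have [cenR zR] :
    poly_centraliser (rep (zclass A)) /\ zclass (rep (zclass A)) = zclass A.
  by apply: (@xgetPex _ _ [set B : GL k n.+1 |
    poly_centraliser B /\ zclass B = zclass A]); exists A.
(* [A] belongs to its own class, by conjugation with 1, and this is also the class of the
   representative. *)
have zRA : zequiv (rep (zclass A)) A.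
  have : zclass A A.
    by exists 1%g; rewrite (eq_imagel (fun h _ => conjg1 h)) image_id.
  by rewrite -{1}zR.
have [b Rb ->] := zequiv_field_adjoin cenA cenR zRA Aa.
by exists b.
Qed.
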